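(* Let $b>1$ and $n\in\mathbb N$. Then the (unique) best $d_{\sf L}$-approximation $\delta_\bullet^{\bullet,n}$ of $\beta_b$ is $\delta_x^p$, with $$x_j=b^{(2j-1)L}+2L\,\frac{b^{2jL}-1}{b^{2L}-1}-L=b^{P_j-L}-L,$$ $$P_j=\frac1{\log b}\log\left(b^{(2j-1)L}+2L\,\frac{b^{2jL}-1}{b^{2L}-1}\right)+L=\frac{\log(x_j+L)}{\log b}+L,$$ for all $j=1,\ldots,n$, where $L$ is the unique solution of $$b^{2nL}=\frac{2L+b(b^L-b^{-L})}{2L+b^L-b^{-L}};$$ in particular, $\#\,\mathrm{supp}\,\delta_\bullet^{\bullet,n}=n$. Moreover, $d_{\sf L}(\beta_b,\delta_\bullet^{\bullet,n})=\omega_bL$, and $$\lim_{n\to\infty}n\,d_{\sf L}(\beta_b,\delta_\bullet^{\bullet,n})=\frac{\max\{b,2\}-1}{2b-2}\cdot\frac{\log(1+b\log b)-\log(1+\log b)}{\log b}.$$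
   Context: For $b>1$, $\beta_b$ is the Borel probability measure on $\mathbb I=[1,b]$ with $\beta_b([1,s])=\log s/\log b$ for all $s\in[1,b[$ ($\log$ is the natural logarithm). For Borel probability measures $\mu,\nu$ on $[1,b]$ with distribution functions $F_\mu,F_\nu$, the (normalized) Lévy distance is $$d_{\sf L}(\mu,\nu)=\omega_b\inf\{y\ge0:F_\mu(\cdot-y)-y\le F_\nu\le F_\mu(\cdot+y)+y\},\qquad \omega_b=\frac{\max\{b,2\}-1}{b-1}.$$ For $n\in\mathbb N$: $\Xi_n=\{x\in[1,b]^n:x_1\le\ldots\le x_n\}$, $\Pi_n=\{p\in\mathbb R^n:p_j\ge0,\sum_{j=1}^np_j=1\}$, $P_j=\sum_{i=1}^jp_i$, $\delta_x^p=\sum_{j=1}^np_j\delta_{x_j}$ with $\delta_a$ the Dirac measure at $a$. A best $d_{\sf L}$-approximation of $\mu$ (for given $n$), denoted $\delta_\bullet^{\bullet,n}$, is a measure $\delta_x^p$ with $x\in\Xi_n$, $p\in\Pi_n$ such that $d_{\sf L}(\mu,\delta_x^p)\le d_{\sf L}(\mu,\delta_y^q)$ for all $y\in\Xi_n$, $q\in\Pi_n$. *)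

(* Defs.v *)
From HB Require Import structures.
From mathcomp Require Import all_boot all_order all_algebra.
From mathcomp Require Import all_classical all_reals all_analysis.

Set Implicit Arguments.
Unset Strict Implicit.
Unset Printing Implicit Defensive.

Import Order.TTheory GRing.Theory Num.Theory.
Import numFieldNormedType.Exports.

Local Open Scope classical_set_scope.
Local Open Scope ring_scope.

Section distances.
Variable R : realType.
Implicit Types (b t y : R) (mu nu : probability (measurableTypeR R) R).

Definition distr_fun mu t : R := fine (mu `]-oo, t]%classic).

Definition levy_omega b : R := (Num.max b 2 - 1) / (b - 1).

(* The bounds are required at every real t, also outside [1, b]; they always
   hold for y = 1, so [inf] is a genuine infimum. *)
Definition levy_dist b mu nu : R :=
  levy_omega b * inf [set y | 0 <= y /\
    forall t, distr_fun mu (t - y) - y <= distr_fun nu t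
                <= distr_fun mu (t + y) + y].

Definition msupport mu : set R :=
  [set t | forall U : set R, open U -> U t -> (0 < mu U)%E].

Definition is_benford b mu : Prop :=
  mu `[1, b]%classic = 1%E /\
  forall s, 1 <= s < b -> mu `[1, s]%classic = (ln s / ln b)%:E.

End distances.

Section finitely_supported.
Variable R : realType.

(* Vectors (x_1, ..., x_n) are functions on 'I_n, so x_j is [x i] with
   j = i.+1. *)
Definition Xi b n (x : 'I_n -> R) : Prop :=
  (forall i, 1 <= x i <= b) /\ (forall i k : 'I_n, (i <= k)%N -> x i <= x k).

Record simplex n := Simplex {
  weight :> 'I_n -> R;
  weight_ge0 : forall i, 0 <= weight i;
  weight_sum1 : \sum_(i < n) weight i = 1 }.

Definition cumul n (p : simplex n) (i : 'I_n) : R :=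
  \sum_(k < n | (k <= i)%N) p k.

Section wdirac.
Variables (n : nat) (x : 'I_n -> R) (p : simplex n).
Local Open Scope ereal_scope.

Definition wdirac (A : set (measurableTypeR R)) : \bar R :=
  \sum_(i < n) (p i)%:E * \d_(x i) A.

Let wdirac0 : wdirac set0 = 0.
Proof. by apply: big1 => i _; rewrite measure0 mule0. Qed.

Let wdirac_ge0 A : 0 <= wdirac A.
Proof. by apply: sume_ge0 => i _; rewrite mule_ge0// lee_fin weight_ge0. Qed.

Let wdirac_sigma_additive : semi_sigma_additive wdirac.
Proof.
move=> F mF tF mUF; rewrite /wdirac.
pose q i := NngNum (weight_ge0 p i).
have qE i A : (p i)%:E * \d_(x i) A = mscale (q i) (\d_(x i)) A by [].
rewrite (_ : (fun m => _) = fun m =>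
    \sum_(i < n) \sum_(0 <= k < m) mscale (q i) (\d_(x i)) (F k)); last first.
  by apply/funext => m; rewrite exchange_big.
under [X in _ --> X]eq_bigr do rewrite qE.
apply: cvg_nnesum => i _; last exact: measure_semi_sigma_additive.
by apply: nearW => m; exact: sume_ge0.
Qed.

HB.instance Definition _ := isMeasure.Build _ _ _ wdirac
  wdirac0 wdirac_ge0 wdirac_sigma_additive.

Let wdirac_setT : wdirac setT = 1.
Proof.
rewrite /wdirac; under eq_bigr do rewrite diracT mule1.
by rewrite sumEFin weight_sum1.
Qed.

HB.instance Definition _ := @Measure_isProbability.Build _ _ R
  wdirac wdirac_setT.

End wdirac.

Definition best_approx b n (mu nu : probability (measurableTypeR R) R) : Prop :=
  (exists x (p : simplex n), Xi b x /\
     forall A, measurable A -> nu A = wdirac x p A) /\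
  forall y (q : simplex n), Xi b y ->
    levy_dist b mu nu <= levy_dist b mu (wdirac y q).

End finitely_supported.

Definition levy_equation (R : realType) (b : R) (n : nat) (L : R) : Prop :=
  2 * L + b `^ L - b `^ (- L) != 0 /\
  b `^ (2 * n%:R * L) =
    (2 * L + b * (b `^ L - b `^ (- L))) / (2 * L + b `^ L - b `^ (- L)).

(* Such a measure exists: it is the law of b `^ U with U uniform on [0, 1]. *)
Lemma is_benford_exists (R : realType) (b : R) : 1 < b ->
  exists mu : probability (measurableTypeR R) R, is_benford b mu.
Proof.
move=> b1; have b0 : 0 < b by exact: lt_trans b1.
have lnb0 : 0 < ln b by exact: ln_gt0.
have mX : measurable_fun setT (powR b : measurableTypeR R -> measurableTypeR R).
  exact: measurable_realfun.measurable_powRr.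
pose X : {mfun measurableTypeR R >-> measurableTypeR R} :=
    @mfun_Sub _ _ (measurableTypeR R) (measurableTypeR R) (powR b) (mem_set mX).
have muE s : 1 <= s <= b ->
    distribution (uniform_prob (@ltr01 R)) X `[1, s]%classic
    = (ln s / ln b)%:E.
  move=> /andP[s1 sb]; have s0 : 0 < s by exact: lt_le_trans s1.
  rewrite /distribution /pushforward/=.
  have -> : X @^-1` `[1, s]%classic = `[0, ln s / ln b]%classic.
    apply/seteqP; split => t /=; rewrite !in_itv/= ler_pdivlMr//.
      move=> /andP[t1 ts]; rewrite -(@ln_powR R b t).
      rewrite ler_ln ?posrE ?powR_gt0// ts andbT.
      by rewrite -(@pmulr_lge0 _ (ln b))// -ln_powR ln_ge0.
    move=> /andP[t0 ts]; rewrite -(ler_ln (x := b `^ t)) ?posrE ?powR_gt0//.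
    rewrite ln_powR ts andbT -[leLHS](powRr0 b).
    by rewrite ler_powR// ltW.
  rewrite /uniform_prob integral_uniform_pdf setIidl; last first.
    move=> t /=; rewrite !in_itv/= => /andP[-> ts]; apply: le_trans ts _.
    by rewrite ler_pdivrMr// mul1r ler_ln.
  rewrite (eq_integral (fun=> 1%E)); last first.
    move=> t; rewrite inE/= in_itv/= /uniform_pdf => /andP[t0 ts].
    rewrite t0 subr0 invr1 (le_trans ts)//.
    by rewrite ler_pdivrMr// mul1r ler_ln.
  rewrite integral_cst//= mul1e lebesgue_measure_itv/= lte_fin.
  have [//|le0] := ltP; first by rewrite -EFinB subr0.
  congr EFin; apply/eqP; rewrite eq_sym eq_le le0/=.
  by rewrite divr_ge0 ?ln_ge0// ltW.
exists (distribution (uniform_prob (@ltr01 R)) X); split.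
  by rewrite [LHS]muE ?lexx ?ltW// divff// gt_eqF.
by move=> s /andP[s1 /ltW sb]; rewrite [LHS]muE// s1.
Qed.

(* Main.v *)
Require Import Defs.
From mathcomp Require Import all_boot all_order all_algebra.
From mathcomp Require Import all_classical all_reals all_analysis.
From mathcomp Require Import ring lra.

Set Implicit Arguments.
Unset Strict Implicit.
Unset Printing Implicit Defensive.

Import Order.TTheory GRing.Theory Num.Theory.
Import numFieldNormedType.Exports.

Local Open Scope classical_set_scope.
Local Open Scope ring_scope.

(** Let F be the distribution function of beta, which is log_b clamped to
    [0, 1], and write P_m for the sum of the first m weights of a measure
    delta carried by x_1 <= ... <= x_n.  Since F is monotone and continuous,
    the two inequalities F (t - y) - y <= F_delta (t) <= F (t + y) + y need
    only be tested at the jumps of F_delta, where they read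
      F (x_i - y) <= P_(i-1) + y   and   P_i - y <= F (x_i + y)
    (levy_admissibleP).  Up to clamping, this says that x_i lies between
    b^(P_i - y) - y and b^(P_(i-1) + y) + y; a suitable x_i exists only if
      b^(P_i - y) <= b^(2 y) b^(P_(i-1) - y) + 2 y.
    The sequence w_m = b^(P_m - y) starts at b^(-y) and ends at b^(1 - y), so
    comparison with the solution node of the same recursion with equality
    gives b <= b^y node y n =: reach n y (base_le_reach).  The function reach
    n is increasing, hence y >= L where L > 0 solves reach n L = b; that
    equation is the equation for L in the theorem, cleared of its
    denominators (levy_equationP).

    Conversely, for y = L the recursion with equality ends exactly at
    b^(1 - L), so it defines admissible positions and weights
    (opt_admissible), and L is the optimal value.  If a measure has the
    value L then, the infimum being attained (levy_admissible_inf), all the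
    inequalities above must be equalities, which determines first the P_m and
    then the x_i (csum_eq_node, atom_eq_node): the minimizer is unique.

    For the asymptotics, the equation for L is
      2 n L ln b = ln (1 + b r) - ln (1 + r)  with  r = (b^L - b^(-L)) / (2 L).
    As n L stays bounded, L tends to 0 and r tends to ln b. *)

(** * The recursion of the optimal nodes and the equation for L *)

Section reach_function.
Context {R : realType}.
Variable b : R.
Hypothesis b1 : 1 < b.
Implicit Types (n m : nat) (y L : R).

Lemma base_gt0 : 0 < b. Proof. exact: lt_trans b1. Qed.

Lemma ln_base_gt0 : 0 < ln b. Proof. exact: ln_gt0. Qed.

Lemma ltr_powR_base : {mono powR b : x y / x < y}.
Proof.
move=> x y; rewrite /powR gt_eqF ?base_gt0//.
by rewrite ltr_expR ltr_pM2r ?ln_base_gt0.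
Qed.

Lemma ler_powR_base : {mono powR b : x y / x <= y}.
Proof. by move=> x y; rewrite !leNgt ltr_powR_base. Qed.

Lemma powR_base_inj : injective (powR b).
Proof.
by move=> x y e; apply/le_anti/andP; split; rewrite -ler_powR_base e.
Qed.

Lemma powRD_base x y : b `^ (x + y) = b `^ x * b `^ y.
Proof. by apply: powRD; rewrite (gt_eqF base_gt0) implybT. Qed.

Lemma powR_ln_base x : 0 < x -> b `^ (ln x / ln b) = x.
Proof.
move=> x0; rewrite /powR gt_eqF ?base_gt0// divfK ?gt_eqF ?ln_base_gt0//.
by rewrite lnK.
Qed.

Lemma powR_base_gt1 x : (1 < b `^ x) = (0 < x).
Proof. by rewrite -[1 in LHS](powRr0 b) ltr_powR_base. Qed.

Lemma powR_base_ge1 x : (1 <= b `^ x) = (0 <= x).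
Proof. by rewrite -[1 in LHS](powRr0 b) ler_powR_base. Qed.

(** The solution of node_(m+1) = b^(2 y) node_m + 2 y with node_0 = b^(-y),
    see node0 and nodeS. *)
Definition node y m : R :=
  b `^ ((2 * m%:R - 1) * y) + 2 * y * \sum_(k < m) b `^ (2 * k%:R * y).

Lemma node0 y : node y 0 = b `^ (- y).
Proof. by rewrite /node big_ord0 !mulr0 addr0 sub0r mulN1r. Qed.

Lemma nodeS y m : node y m.+1 = b `^ (2 * y) * node y m + 2 * y.
Proof.
have S : \sum_(k < m.+1) b `^ (2 * k%:R * y)
    = 1 + b `^ (2 * y) * \sum_(k < m) b `^ (2 * k%:R * y).
  rewrite big_ord_recl/= mulr0 mul0r powRr0 mulr_sumr; congr (_ + _).
  apply: eq_bigr => i _; rewrite -powRD_base; congr powR.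
  by rewrite /bump/= add1n -natr1; ring.
have E : b `^ ((2 * m.+1%:R - 1) * y)
    = b `^ (2 * y) * b `^ ((2 * m%:R - 1) * y).
  by rewrite -powRD_base; congr powR; rewrite -natr1; ring.
by rewrite /node S E; ring.
Qed.

Lemma node_gt0 y m : 0 <= y -> 0 < node y m.
Proof.
move=> y0; rewrite /node; apply: ltr_pwDl; first by rewrite powR_gt0// base_gt0.
by rewrite mulr_ge0 ?mulr_ge0// sumr_ge0// => k _; exact: powR_ge0.
Qed.

Lemma node_ltS y m : 0 < y -> node y m < node y m.+1.
Proof.
move=> y0; rewrite nodeS ltr_wpDr ?mulr_ge0 ?ltW//.
rewrite -[ltLHS]mul1r ltr_pM2r ?node_gt0// ?ltW//.
by rewrite powR_base_gt1 mulr_gt0.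
Qed.

Lemma node_geometric y m : 0 < y ->
  node y m = b `^ ((2 * m%:R - 1) * y)
    + 2 * y * ((b `^ (2 * m%:R * y) - 1) / (b `^ (2 * y) - 1)).
Proof.
move=> y0; congr (_ + _ * _).
have E (k : nat) : b `^ (2 * k%:R * y) = (b `^ (2 * y)) ^+ k.
  by rewrite mulrAC [LHS]powRrM [LHS]powR_mulrn ?powR_ge0.
under eq_bigr do rewrite E.
have q1 : 1 < b `^ (2 * y) by rewrite powR_base_gt1 mulr_gt0.
by rewrite E subrX1 mulrAC divff ?mul1r// subr_eq0 gt_eqF.
Qed.

(** This is b^y * node y n (reachE), expanded so that every term is visibly
    nondecreasing in y >= 0. *)
Definition reach n y : R :=
  b `^ (2 * n%:R * y) + 2 * y * \sum_(k < n) b `^ ((2 * k%:R + 1) * y).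

Lemma reachE n y : reach n y = b `^ y * node y n.
Proof.
have -> : reach n y = b `^ y * b `^ ((2 * n%:R - 1) * y)
    + 2 * y * (b `^ y * \sum_(k < n) b `^ (2 * k%:R * y)).
  rewrite /reach -powRD_base [b `^ y * _]mulr_sumr.
  congr (b `^ _ + _ * _); first by ring.
  by apply: eq_bigr => k _; rewrite -powRD_base; congr powR; ring.
by rewrite /node; ring.
Qed.

Lemma reach_lt n y1 y2 : (0 < n)%N -> 0 <= y1 -> y1 < y2 ->
  reach n y1 < reach n y2.
Proof.
move=> n0 y10 y12; rewrite /reach ltr_leD//.
  by rewrite ltr_powR_base ltr_pM2l// mulr_gt0// ltr0n.
apply: ler_pM; rewrite ?mulr_ge0//.
- by rewrite sumr_ge0// => k _; exact: powR_ge0.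
- by rewrite ler_pM2l// ltW.
by apply: ler_sum => k _; rewrite ler_powR_base ler_pM2l ?ltW.
Qed.

Lemma continuous_powR_base : continuous (powR b).
Proof.
move=> x; have -> : powR b = fun t => expR (t * ln b).
  by apply/funext => t; rewrite /powR gt_eqF ?base_gt0.
apply: continuous_comp; first exact: (@mulrr_continuous _ (ln b)).
exact: continuous_expR.
Qed.

Lemma continuous_reach n : continuous (reach n).
Proof.
have pc c : continuous (fun t : R => b `^ (c * t)).
  move=> t; apply: continuous_comp; last exact: continuous_powR_base.
  exact: (@mulrl_continuous _ c).
move=> y; apply: cvgD; first exact: pc.
apply: cvgM; first exact: (@mulrl_continuous _ 2).
apply: cvg_big => [|k _]; first exact: add_continuous; exact: pc.
Qed.

Lemma reach_root n : (0 < n)%N -> exists2 L, 0 < L & reach n L = b.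
Proof.
move=> n0; have r0 : reach n 0 < b.
  by rewrite /reach !mulr0 powRr0 mul0r addr0.
have r1 : b <= reach n 1.
  rewrite /reach !mulr1; apply: (@le_trans _ _ (b `^ (2 * n%:R))).
    rewrite -[leLHS](powRr1 (ltW base_gt0)) ler_powR_base.
    by rewrite -natrM ler1n muln_gt0.
  rewrite lerDl mulr_ge0// sumr_ge0// => k _; exact: powR_ge0.
have [||L] := @IVT R (reach n) 0 1 b ler01.
- by apply: continuous_subspaceT; exact: continuous_reach.
- by rewrite min_l ?max_r ?(ltW r0)//= (le_trans (ltW r0) r1).
rewrite in_itv/= => /andP[L0 _] rL; exists L => //.
by rewrite lt_neqAle L0 andbT; apply: contraTneq r0 => ->; rewrite rL ltxx.
Qed.

(** For L > 0, multiplying reach n L = b by s = b^L - b^(-L) sums the geometric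
    series and gives the Levy equation without its denominator.  For L < 0 the
    Levy equation fails because its right-hand side, being even in L, exceeds
    1; at L = 0 its denominator vanishes. *)
Lemma levy_equationP n L : (0 < n)%N ->
  levy_equation b n L <-> 0 < L /\ reach n L = b.
Proof.
move=> n0; rewrite /levy_equation.
set s := b `^ L - b `^ (- L).
rewrite -addrA -/s.
have [L0|L0|L0] := ltgtP L 0.
- split=> [[d0 e]|[]//]; exfalso.
  have s0 : s < 0 by rewrite subr_lt0 ltr_powR_base; lra.
  have : b `^ (2 * n%:R * L) < 1.
    by rewrite -[ltRHS](powRr0 b) ltr_powR_base pmulr_rlt0// mulr_gt0// ltr0n.
  rewrite e ltr_ndivrMr ?mul1r; last by lra.
  rewrite ltrD2l ltr_nMl//; apply/negP; rewrite -leNgt; exact: ltW.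
- have s0 : 0 < s by rewrite subr_gt0 ltr_powR_base; lra.
  have d0 : 2 * L + s != 0 by rewrite gt_eqF//; lra.
  have q0 : b `^ L != 0 by rewrite gt_eqF// powR_gt0// base_gt0.
  have q1 : b `^ (2 * L) - 1 != 0.
    by rewrite subr_eq0 gt_eqF// powR_base_gt1 mulr_gt0.
  have sE : s * b `^ L = b `^ (2 * L) - 1.
    rewrite /s mulrBl -!powRD_base addNr powRr0; congr (b `^ _ - _); ring.
  have gE : s * \sum_(k < n) b `^ ((2 * k%:R + 1) * L)
      = b `^ (2 * n%:R * L) - 1.
    have E (k : nat) : b `^ (2 * k%:R * L) = (b `^ (2 * L)) ^+ k.
      by rewrite mulrAC [LHS]powRrM [LHS]powR_mulrn ?powR_ge0.
    rewrite E subrX1 -sE -mulrA [b `^ L * _]mulr_sumr; congr (_ * _).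
    apply: eq_bigr => k _; rewrite -E -powRD_base; congr powR; ring.
  have rE : s * reach n L
      = s * b `^ (2 * n%:R * L) + 2 * L * (b `^ (2 * n%:R * L) - 1).
    by rewrite /reach mulrDr mulrCA gE.
  split=> [[_ e]|[_ rL]].
    split=> //; apply: (mulfI (lt0r_neq0 s0)); rewrite rE.
    have : b `^ (2 * n%:R * L) * (2 * L + s) = 2 * L + b * s by rewrite e divfK.
    lra.
  split=> //; apply/esym/(canLR (mulfK d0)); rewrite rL in rE; lra.
- by split=> [[]|[]]; rewrite /s L0 ?ltxx// oppr0 subrr mulr0 addr0 eqxx.
Qed.
End reach_function.

(** * The distribution function of the Benford measure *)

Section benford_cdf.
Context {R : realType}.
Variable b : R.
Hypothesis b1 : 1 < b.
Implicit Types (s t p : R).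

Definition benford_cdf t : R := ln (Num.max 1 (Num.min t b)) / ln b.

Let clamp_gt0 t : 0 < Num.max 1 (Num.min t b).
Proof. by rewrite lt_max ltr01. Qed.

Lemma powR_benford_cdf t : b `^ (benford_cdf t) = Num.max 1 (Num.min t b).
Proof. exact: powR_ln_base. Qed.

Lemma benford_cdf_ge0 t : 0 <= benford_cdf t.
Proof. by rewrite -(powR_base_ge1 b1) powR_benford_cdf le_max lexx. Qed.

Lemma benford_cdf_le1 t : benford_cdf t <= 1.
Proof.
rewrite -(ler_powR_base b1) powR_benford_cdf (powRr1 (ltW (base_gt0 b1))).
by rewrite ge_max (ltW b1) ge_min lexx orbT.
Qed.

Lemma benford_cdf_homo s t : s <= t -> benford_cdf s <= benford_cdf t.
Proof.
move=> st; rewrite -(ler_powR_base b1) !powR_benford_cdf.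
by apply: le_max2; rewrite // le_min2.
Qed.

(** ln is 1-Lipschitz on [1, +oo[, where the clamped argument lives. *)
Lemma benford_cdf_lipschitz s t : s <= t ->
  benford_cdf t <= benford_cdf s + (t - s) / ln b.
Proof.
move=> st; rewrite -lerBlDl -mulrBl ler_pM2r ?invr_gt0 ?ln_base_gt0//.
rewrite -ln_div ?posrE//.
set u := Num.max 1 (Num.min s b); set v := Num.max 1 (Num.min t b).
have u1 : 1 <= u by rewrite le_max lexx.
have u0 : 0 < u by exact: lt_le_trans u1.
have uv : u <= v by apply: le_max2; rewrite // le_min2.
have vu : v - u <= t - s.
  rewrite /u /v; case: (ltP s b) => ?; case: (ltP t b) => ?;
    by do ?[case: (ltP 1) => ?]; lra.
have -> : v / u = 1 + (v - u) / u by rewrite mulrBl divff ?gt_eqF// subrKC.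
apply: (le_trans (le_ln1Dx _)).
  by apply: (@lt_le_trans _ _ 0); rewrite ?ltrN10// divr_ge0 ?subr_ge0// ltW.
apply: le_trans vu; rewrite ler_pdivrMr//.
by rewrite ler_peMr// subr_ge0.
Qed.

Lemma le_benford_cdf p s : 0 < p -> p <= benford_cdf s -> b `^ p <= s.
Proof.
move=> p0; rewrite -(ler_powR_base b1) powR_benford_cdf le_max.
by rewrite leNgt powR_base_gt1// p0/= le_min => /andP[].
Qed.

Lemma benford_cdf_le p s : p < 1 -> benford_cdf s <= p -> s <= b `^ p.
Proof.
move=> p0; rewrite -(ler_powR_base b1) powR_benford_cdf ge_max => /andP[_].
rewrite ge_min => /orP[//|].
by rewrite -{1}(powRr1 (ltW (base_gt0 b1))) ler_powR_base// leNgt p0.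
Qed.

Lemma benford_cdf_powR_ge p : p <= 1 -> p <= benford_cdf (b `^ p).
Proof.
move=> p1; rewrite -(ler_powR_base b1) powR_benford_cdf le_max le_min lexx/=.
by rewrite ler1_powR ?orbT// ltW.
Qed.

Lemma benford_cdf_powR_le p : 0 <= p -> benford_cdf (b `^ p) <= p.
Proof.
move=> p0; rewrite -(ler_powR_base b1) powR_benford_cdf ge_max ge_min lexx.
by rewrite powR_base_ge1// p0.
Qed.

Lemma benford_cdf_eq0 t : t <= 1 -> benford_cdf t = 0.
Proof.
move=> t1; rewrite /benford_cdf min_l ?(le_trans t1 (ltW b1))// max_l//.
by rewrite ln1 mul0r.
Qed.

Lemma benford_cdfE t : 1 <= t -> t <= b -> benford_cdf t = ln t / ln b.
Proof. by move=> t1 tb; rewrite /benford_cdf min_l// max_r. Qed.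

Lemma benford_cdf_eq1 t : b <= t -> benford_cdf t = 1.
Proof.
move=> bt; rewrite /benford_cdf min_r// max_r ?(ltW b1)// divff//.
by rewrite gt_eqF// ln_base_gt0.
Qed.

Lemma distr_fun_benford (beta : probability (measurableTypeR R) R) t :
  is_benford b beta -> distr_fun beta t = benford_cdf t.
Proof.
move=> [beta1 betaE].
pose D : set (measurableTypeR R) := `[1, b]%classic.
have mD : measurable D by exact: measurable_itv.
have mt : measurable (`]-oo, t]%classic : set (measurableTypeR R)).
  exact: measurable_itv.
have betaC : beta (~` D) = 0%E.
  by rewrite probability_setC// beta1 subee.
have betaI : beta `]-oo, t]%classic = beta (`]-oo, t]%classic `&` D).
  rewrite -[in LHS](setIT `]-oo, t]%classic) -(setUv D) setIUr.
  rewrite measureU//=; last 3 first.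
  - exact: measurableI.
  - by apply: measurableI => //; exact: measurableC.
  - by rewrite -setIIr setICr setI0.
  rewrite [X in (_ + X)%E](_ : _ = 0%E) ?adde0//.
  apply: (subset_measure0 _ _ _ betaC) => //.
  - by apply: measurableI => //; exact: measurableC.
  - exact: measurableC.
rewrite /distr_fun betaI /D.
have [t1|t1] := ltP t 1.
  rewrite (_ : _ `&` _ = set0) ?measure0 ?benford_cdf_eq0 ?ltW//.
  by rewrite -subset0 => u/= []; rewrite !in_itv/=; lra.
have [tb|tb] := ltP t b.
  rewrite (_ : _ `&` _ = `[1, t]%classic).
    by rewrite betaE ?t1//= benford_cdfE// ltW.
  by apply/seteqP; split => u/=; rewrite !in_itv/=; lra.
rewrite (_ : _ `&` _ = `[1, b]%classic) ?beta1 ?benford_cdf_eq1//.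
by apply/seteqP; split => u/=; rewrite !in_itv/=; lra.
Qed.
End benford_cdf.

(** * Distribution functions of finitely supported measures *)

Section step_functions.
Context {R : realType} {n : nat}.
Variables (x : 'I_n -> R) (p : simplex R n).
Implicit Types (t : R) (m : nat).

Lemma distr_fun_wdirac t :
  distr_fun (wdirac x p) t = \sum_(k < n | x k <= t) p k.
Proof.
rewrite /distr_fun /= /wdirac.
rewrite (eq_bigr (fun k => (if x k <= t then p k else 0)%:E)); last first.
  move=> k _; rewrite diracE.
  case: ifPn => xt; first by rewrite mem_set ?mule1//= in_itv.
  by rewrite memNset ?mule0//= in_itv/=; apply/negP.
by rewrite sumEFin/= -big_mkcond.
Qed.

(** The sums P_m with the index shifted to nat, so that P_0 = 0 is included;
    cumul p i is csum i.+1. *)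
Definition csum m : R := \sum_(k < n | (k < m)%N) p k.

Lemma csum0 : csum 0 = 0.
Proof. by rewrite /csum big1. Qed.

Lemma csum_all m : (n <= m)%N -> csum m = 1.
Proof.
move=> nm; rewrite -(weight_sum1 p); apply: eq_bigl => k.
exact: leq_trans nm.
Qed.

Lemma csumS (i : 'I_n) : csum i.+1 = csum i + p i.
Proof.
rewrite /csum (bigD1 i)//= addrC; congr (_ + _).
by apply: eq_bigl => k; rewrite ltnS ltn_neqAle andbC.
Qed.

Lemma csum_ge0 m : 0 <= csum m.
Proof. by apply: sumr_ge0 => k _; exact: weight_ge0. Qed.

Let ler_sum_weight (P Q : pred 'I_n) : (forall k, P k -> Q k) ->
  \sum_(k < n | P k) p k <= \sum_(k < n | Q k) p k.
Proof.
move=> PQ; rewrite big_mkcond [leRHS]big_mkcond/=; apply: ler_sum => k _.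
case: ifPn => [/PQ -> //|_]; case: ifP => // _; exact: weight_ge0.
Qed.

Lemma csum_le1 m : csum m <= 1.
Proof. by rewrite -(weight_sum1 p); exact: ler_sum_weight. Qed.

Lemma csum_le_distr m t :
  (forall k : 'I_n, (k < m)%N -> x k <= t) ->
  csum m <= distr_fun (wdirac x p) t.
Proof. by rewrite distr_fun_wdirac; exact: ler_sum_weight. Qed.

Lemma distr_le_csum m t :
  (forall k : 'I_n, x k <= t -> (k < m)%N) ->
  distr_fun (wdirac x p) t <= csum m.
Proof. by rewrite distr_fun_wdirac; exact: ler_sum_weight. Qed.
End step_functions.

(** * The Levy distance to the Benford measure *)

Section admissible.
Context {R : realType}.
Variable b : R.
Hypothesis b1 : 1 < b.
Variable beta : probability (measurableTypeR R) R.
Hypothesis hbeta : is_benford b beta.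
Implicit Types (y t : R) (nu : probability (measurableTypeR R) R).

Definition levy_admissible nu : set R := [set y | 0 <= y /\
  forall t, distr_fun beta (t - y) - y <= distr_fun nu t
              <= distr_fun beta (t + y) + y].

Local Notation F := (benford_cdf b).

Let betaE t : distr_fun beta t = F t.
Proof. exact: distr_fun_benford. Qed.

Lemma levy_admissible1 nu : levy_admissible nu 1.
Proof.
have d01 (mu : probability (measurableTypeR R) R) t : 0 <= distr_fun mu t <= 1.
  rewrite fine_ge0//= -[leRHS]/(fine 1%E) fine_le ?fin_num_measure//.
  exact: probability_le1.
split=> // t; have := d01 beta (t - 1); have := d01 beta (t + 1).
by have := d01 nu t; lra.
Qed.

(** The Lipschitz bound on F makes the admissible set closed, so that the
    infimum in the Levy distance is attained. *)
Lemma levy_admissible_inf nu : levy_admissible nu (inf (levy_admissible nu)).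
Proof.
set S := levy_admissible nu; set y0 := inf S.
have hS : has_inf S.
  split; first by exists 1; exact: levy_admissible1.
  by exists 0 => y [].
have l0 := ln_base_gt0 b1.
have e0 : 0 < 1 + (ln b)^-1 by rewrite addr_gt0// invr_gt0.
have y00 : 0 <= y0 by apply: lb_le_inf; [exact: hS.1|by move=> y []].
split=> // t.
suff H e : 0 < e ->
    distr_fun beta (t - y0) - y0 - e <= distr_fun nu t
      <= distr_fun beta (t + y0) + y0 + e.
  apply/andP; split; apply/ler_addgt0Pr => e /H; lra.
move=> e_gt0; have d0 : 0 < e / (1 + (ln b)^-1) by rewrite divr_gt0.
have [y Sy] := inf_adherent d0 hS; rewrite -/y0 => yd.
have y0y : y0 <= y by apply: ge_inf => //; exact: hS.2.
have := Sy.2 t; rewrite !betaE.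
have s1 : t - y <= t - y0 by lra.
have s2 : t + y0 <= t + y by lra.
have := benford_cdf_lipschitz b1 s1; have := benford_cdf_lipschitz b1 s2.
rewrite (_ : t - y0 - (t - y) = y - y0); last by ring.
rewrite (_ : t + y - (t + y0) = y - y0); last by ring.
(* Moving the argument of F by y - y0 and the threshold by y - y0 costs
   (y - y0) * (1 + 1 / ln b) altogether. *)
have : (y - y0) * (1 + (ln b)^-1) < e by rewrite -ltr_pdivlMr//; lra.
lra.
Qed.

(** The distribution function of wdirac x p is constant between consecutive
    atoms.  The upper bound is therefore sharpest at an atom, and the lower
    bound sharpest just to the left of one; the Lipschitz bound replaces the
    left limit of F there by its value.  Ties among the atoms are harmless,
    as only the inequalities csum_le_distr and distr_le_csum are used. *)
Lemma levy_admissibleP n (x : 'I_n -> R) (p : simplex R n) y :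
  Xi b x -> 0 <= y ->
  levy_admissible (wdirac x p) y <->
  forall i : 'I_n, F (x i - y) <= csum p i + y /\
                   csum p i.+1 - y <= F (x i + y).
Proof.
move=> [_ x_homo] y0; split=> [[_ adm] i|H].
  split; last first.
    have /andP[_ h] := adm (x i); rewrite betaE in h.
    rewrite lerBlDr; apply: le_trans h; apply: csum_le_distr => k.
    by rewrite ltnS => /x_homo.
  (* Moving left by e * ln b costs e by the Lipschitz bound. *)
  apply/ler_addgt0Pr => e e0.
  have d0 : 0 < e * ln b by rewrite mulr_gt0// ln_base_gt0.
  have /andP[h _] := adm (x i - e * ln b).
  rewrite betaE in h.
  have h1 : distr_fun (wdirac x p) (x i - e * ln b) <= csum p i.
    apply: distr_le_csum => k xk; rewrite ltnNge; apply/negP => /x_homo; lra.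
  have st : x i - e * ln b - y <= x i - y by lra.
  have := benford_cdf_lipschitz b1 st.
  rewrite (_ : (x i - y - (x i - e * ln b - y)) / ln b = e); first by lra.
  by field; rewrite gt_eqF// ln_base_gt0.
split=> // t; rewrite !betaE; apply/andP; split.
  have [/forallP xt|/forallPn[k0 xk0]] := boolP [forall k, x k <= t].
    have := @csum_le_distr _ _ x p n t (fun k _ => xt k).
    rewrite csum_all//; have := benford_cdf_le1 b1 (t - y); lra.
  have [k xk kmin] := @arg_minnP _ k0 (fun k => ~~ (x k <= t)) val xk0.
  have h1 : csum p k <= distr_fun (wdirac x p) t.
    apply: csum_le_distr => j jk; apply/negPn/negP => /kmin.
    by rewrite leqNgt jk.
  have [h2 _] := H k.
  have : F (t - y) <= F (x k - y).
    apply: benford_cdf_homo => //; rewrite -ltNge in xk; lra.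
  lra.
have [/existsP[k0 xk0]|/existsPn xt] := boolP [exists k, x k <= t].
  have [k xk kmax] := @arg_maxnP _ k0 (fun k => x k <= t) val xk0.
  have h1 : distr_fun (wdirac x p) t <= csum p k.+1.
    by apply: distr_le_csum => j /kmax.
  have [_ h2] := H k.
  have : F (x k + y) <= F (t + y) by apply: benford_cdf_homo => //; lra.
  lra.
have h : distr_fun (wdirac x p) t <= csum p 0.
  by apply: distr_le_csum => k; rewrite (negbTE (xt k)).
rewrite csum0 in h; have := benford_cdf_ge0 b1 (t + y); lra.
Qed.
Lemma levy_omega_gt0 : 0 < levy_omega b.
Proof. by rewrite divr_gt0 ?subr_gt0// lt_max b1. Qed.

Lemma eq_levy_dist (mu nu nu' : probability (measurableTypeR R) R) :
  (forall A, measurable A -> nu A = nu' A) ->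
  levy_dist b mu nu = levy_dist b mu nu'.
Proof.
move=> E; rewrite /levy_dist; congr (_ * inf _).
have d t : distr_fun nu t = distr_fun nu' t.
  by rewrite /distr_fun E//; exact: measurable_itv.
apply/seteqP; split => y [? h]; split=> // t; have := h t; by rewrite d.
Qed.

End admissible.

(** * The lower bound and its equality case *)

Section lower_bound.
Context {R : realType}.
Variable b : R.
Hypothesis b1 : 1 < b.
Variable beta : probability (measurableTypeR R) R.
Hypothesis hbeta : is_benford b beta.
Variables (n : nat) (x : 'I_n -> R) (p : simplex R n) (y : R).
Hypothesis xXi : Xi b x.
Hypothesis y_adm : levy_admissible beta (wdirac x p) y.
Implicit Types (m : nat).

Let y0 : 0 <= y. Proof. exact: y_adm.1. Qed.

(** The first alternative collects the cases where F is clamped.  There the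
    recursive inequality holds with slack, so it cannot become an equality
    when y > 0. *)
Lemma admissible_step (i : 'I_n) :
  b `^ (csum p i.+1 - y) <= b `^ (csum p i) \/
  b `^ (csum p i.+1 - y) - y <= x i <= b `^ (csum p i + y) + y.
Proof.
have [h1 h2] := (levy_admissibleP b1 hbeta p xXi y0).1 y_adm i.
have c0 := csum_ge0 p i; have c1 := csum_le1 p i.+1.
have [hi|hi] := leP 1 (csum p i + y).
  by left; rewrite ler_powR_base//; lra.
have [lo|lo] := leP (csum p i.+1 - y) 0.
  by left; rewrite ler_powR_base//; lra.
right; have := benford_cdf_le b1 hi h1; have := le_benford_cdf b1 lo h2; lra.
Qed.

Lemma csum_le_node m : (m <= n)%N -> b `^ (csum p m - y) <= node b y m.
Proof.
elim: m => [|m IH] mn; first by rewrite csum0 sub0r node0.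
have {IH} := IH (ltnW mn); rewrite nodeS//.
rewrite -(ler_pM2l (powR_gt0 (2 * y) (base_gt0 b1))) -powRD_base//.
rewrite (_ : 2 * y + (csum p m - y) = csum p m + y); last by ring.
have : b `^ (csum p m) <= b `^ (csum p m + y) by rewrite ler_powR_base// lerDl.
have := admissible_step (Ordinal mn) => /=; have := y0; lra.
Qed.

Lemma base_le_reach : b <= reach b n y.
Proof.
rewrite reachE// -[leLHS](powRr1 (ltW (base_gt0 b1))).
rewrite -[X in b `^ X](subrKC y) powRD_base// ler_pM2l ?powR_gt0 ?base_gt0//.
by have := csum_le_node (leqnn n); rewrite csum_all.
Qed.

Hypothesis y_gt0 : 0 < y.
Hypothesis y_reach : reach b n y = b.

(** Descending induction: at m = n both sides are b^(1 - y), and a strict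
    inequality at m would propagate to m + 1. *)
Lemma csum_eq_node m : (m <= n)%N -> b `^ (csum p m - y) = node b y m.
Proof.
move=> mn; rewrite -(subKn mn); elim: (n - m)%N => [|k IH].
  rewrite subn0 csum_all// powRD_base// powRr1 ?ltW ?base_gt0//.
  rewrite -[X in X * _]y_reach reachE// mulrAC -powRD_base// subrr powRr0.
  by rewrite mul1r.
have [kn|nk] := ltnP k n; last first.
  have e : (n - k = 0)%N := eqP nk.
  by rewrite subnS; rewrite e in IH *.
set j := (n - k.+1)%N in IH *.
have jn : (j < n)%N by rewrite ltn_subrL (leq_ltn_trans _ kn).
rewrite -subnSK// -/j in IH.
apply/le_anti/andP; split; first exact/csum_le_node/ltnW.
have := admissible_step (Ordinal jn) => /=.
rewrite IH nodeS// => h.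
rewrite -(ler_pM2l (powR_gt0 (2 * y) (base_gt0 b1))) -powRD_base//.
rewrite (_ : 2 * y + (csum p j - y) = csum p j + y); last by ring.
have : b `^ (csum p j) <= b `^ (csum p j + y) by rewrite ler_powR_base// lerDl.
have := y_gt0; lra.
Qed.

Lemma csum_eq_ln m : (m <= n)%N -> csum p m = ln (node b y m) / ln b + y.
Proof.
move=> mn; rewrite -csum_eq_node// ln_powR mulfK ?subrK//.
by rewrite gt_eqF// ln_base_gt0.
Qed.

Lemma atom_eq_node (i : 'I_n) : x i = node b y i.+1 - y.
Proof.
have E : b `^ (csum p i + y) = b `^ (2 * y) * node b y i.
  by rewrite -csum_eq_node 1?ltnW// -powRD_base//; congr powR; ring.
have : b `^ (csum p i) <= b `^ (csum p i + y) by rewrite ler_powR_base// lerDl.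
have := admissible_step i; rewrite csum_eq_node// E nodeS//.
have := y_gt0; lra.
Qed.
End lower_bound.

(** * The optimal measure *)

Section optimum.
Context {R : realType}.
Variable b : R.
Hypothesis b1 : 1 < b.
Variable beta : probability (measurableTypeR R) R.
Hypothesis hbeta : is_benford b beta.
Variables (n : nat) (L : R).
Hypothesis n_gt0 : (0 < n)%N.
Hypothesis L_gt0 : 0 < L.
Hypothesis L_reach : reach b n L = b.
Implicit Types (m : nat).

Lemma inf_admissible_ge (x : 'I_n -> R) (p : simplex R n) : Xi b x ->
  L <= inf (levy_admissible beta (wdirac x p)).
Proof.
move=> xXi; have adm := levy_admissible_inf b1 hbeta (wdirac x p).
rewrite leNgt; apply/negP => lt.
have := reach_lt b1 n_gt0 adm.1 lt.
by rewrite L_reach ltNge (base_le_reach b1 hbeta xXi adm).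
Qed.

Definition opt_cumul m : R := ln (node b L m) / ln b + L.

Lemma powR_opt_cumul m : b `^ (opt_cumul m - L) = node b L m.
Proof. by rewrite addrK powR_ln_base// node_gt0// ltW. Qed.

Lemma opt_cumul0 : opt_cumul 0 = 0.
Proof.
apply: (addIr (- L)); apply: (powR_base_inj b1).
by rewrite powR_opt_cumul node0 sub0r.
Qed.

Lemma opt_cumul_all : opt_cumul n = 1.
Proof.
apply: (addIr (- L)); apply: (powR_base_inj b1); rewrite powR_opt_cumul.
rewrite powRD_base// powRr1 ?ltW ?base_gt0// -[X in X * _]L_reach reachE//.
by rewrite mulrAC -powRD_base// subrr powRr0 mul1r.
Qed.

Lemma opt_cumul_ltS m : opt_cumul m < opt_cumul m.+1.
Proof.
by rewrite -(ltrD2r (- L)) -(ltr_powR_base b1) !powR_opt_cumul node_ltS.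
Qed.

Definition opt_weight (i : 'I_n) : R := opt_cumul i.+1 - opt_cumul i.

Lemma opt_weight_gt0 i : 0 < opt_weight i.
Proof. by rewrite subr_gt0 opt_cumul_ltS. Qed.

Lemma opt_weight_ge0 i : 0 <= opt_weight i.
Proof. exact/ltW/opt_weight_gt0. Qed.

Lemma opt_weight_sum1 : \sum_(i < n) opt_weight i = 1.
Proof.
rewrite -(big_mkord xpredT (fun i => opt_cumul i.+1 - opt_cumul i)).
by rewrite telescope_sumr// opt_cumul_all opt_cumul0 subr0.
Qed.

Definition opt_simplex : simplex R n := Simplex opt_weight_ge0 opt_weight_sum1.

Definition opt_atom (i : 'I_n) : R := node b L i.+1 - L.

Lemma csum_opt m : (m <= n)%N -> csum opt_simplex m = opt_cumul m.
Proof.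
elim: m => [|m IH] mn; first by rewrite csum0 opt_cumul0.
by rewrite (csumS _ (Ordinal mn)) IH 1?ltnW//= /opt_weight/= subrKC.
Qed.

Lemma opt_atom_lt (i k : 'I_n) : (i < k)%N -> opt_atom i < opt_atom k.
Proof.
move=> ik; rewrite ltrD2r.
exact: (homo_ltn lt_trans (fun m => node_ltS b1 m L_gt0)).
Qed.

Lemma opt_atom_Xi : Xi b opt_atom.
Proof.
have homo (i k : 'I_n) : (i <= k)%N -> opt_atom i <= opt_atom k.
  by rewrite leq_eqVlt => /predU1P[/val_inj->//|/opt_atom_lt/ltW].
split=> // i; apply/andP; split.
  apply: (@le_trans _ _ (opt_atom (Ordinal n_gt0))); last exact: homo.
  rewrite /opt_atom/= nodeS// node0 -powRD_base//.
  rewrite (_ : 2 * L - L = L); last by ring.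
  have : 1 <= b `^ L by rewrite powR_base_ge1// ltW.
  have := L_gt0; lra.
have nn : (n.-1 < n)%N by rewrite prednK.
apply: (@le_trans _ _ (opt_atom (Ordinal nn))).
  by apply: homo; rewrite /= -ltnS prednK.
rewrite /opt_atom/= prednK// -powR_opt_cumul opt_cumul_all.
have : b `^ (1 - L) <= b by rewrite ler1_powR ?ltW//; have := L_gt0; lra.
have := L_gt0; lra.
Qed.

(** For the optimal atoms, x_i - L = b^(P_(i-1) + L) and x_i + L = b^(P_i - L),
    so both conditions of levy_admissibleP hold with equality up to
    clamping. *)
Lemma opt_admissible : levy_admissible beta (wdirac opt_atom opt_simplex) L.
Proof.
apply/(levy_admissibleP b1 hbeta opt_simplex opt_atom_Xi (ltW L_gt0)) => i.
have cge := csum_ge0 opt_simplex i; have cle := csum_le1 opt_simplex i.+1.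
split.
  rewrite (_ : opt_atom i - L = b `^ (csum opt_simplex i + L)).
    by apply: benford_cdf_powR_le => //; have := L_gt0; lra.
  rewrite /opt_atom nodeS// csum_opt 1?ltnW// -powR_opt_cumul -powRD_base//.
  rewrite (_ : 2 * L + (opt_cumul i - L) = opt_cumul i + L); ring.
rewrite /opt_atom subrK -powR_opt_cumul csum_opt//.
apply: benford_cdf_powR_ge => //; rewrite -csum_opt//; have := L_gt0; lra.
Qed.

Lemma inf_admissible_opt :
  inf (levy_admissible beta (wdirac opt_atom opt_simplex)) = L.
Proof.
apply/le_anti; rewrite inf_admissible_ge ?andbT; last exact: opt_atom_Xi.
by apply: ge_inf; [exists 0 => y []|exact: opt_admissible].
Qed.

Lemma levy_dist_opt :
  levy_dist b beta (wdirac opt_atom opt_simplex) = levy_omega b * L.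
Proof. by rewrite -[in RHS]inf_admissible_opt. Qed.

Lemma levy_dist_ge (x : 'I_n -> R) (p : simplex R n) : Xi b x ->
  levy_omega b * L <= levy_dist b beta (wdirac x p).
Proof.
by move=> xXi; rewrite ler_pM2l ?(levy_omega_gt0 b1)// inf_admissible_ge.
Qed.

Lemma opt_best_approx : best_approx b n beta (wdirac opt_atom opt_simplex).
Proof.
split; first by exists opt_atom, opt_simplex; split=> //; exact: opt_atom_Xi.
by move=> x p xXi; rewrite levy_dist_opt; exact: levy_dist_ge.
Qed.

Lemma levy_dist_best_approx nu : best_approx b n beta nu ->
  levy_dist b beta nu = levy_omega b * L.
Proof.
move=> [[x [p [xXi nuE]]] best]; apply/le_anti/andP; split.
  by rewrite -levy_dist_opt; apply: best; exact: opt_atom_Xi.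
by rewrite (eq_levy_dist b _ nuE); exact: levy_dist_ge.
Qed.

(** The infimum L of a competing minimizer is admissible, so its atoms and
    cumulative weights are in the equality case of the lower bound. *)
Lemma best_approx_unique nu : best_approx b n beta nu ->
  forall A, measurable A -> nu A = wdirac opt_atom opt_simplex A.
Proof.
move=> nub; have := levy_dist_best_approx nub.
case: nub => [[x [p [xXi nuE]]] _].
rewrite (eq_levy_dist b _ nuE).
move=> /(mulfI (lt0r_neq0 (levy_omega_gt0 b1))) infE A mA.
have := levy_admissible_inf b1 hbeta (wdirac x p).
rewrite [X in levy_admissible _ _ X]infE => adm.
rewrite nuE// /wdirac; apply: eq_bigr => i _.
rewrite (atom_eq_node b1 hbeta xXi adm)//; congr (_%:E * _)%E.
apply: (addrI (csum p i)); rewrite -csumS /= /opt_weight.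
by rewrite !(csum_eq_ln b1 hbeta xXi adm)// 1?ltnW// subrKC.
Qed.
End optimum.

(** * Support of a finitely supported measure *)

Section support.
Context {R : realType} {n : nat}.
Variables (x : 'I_n -> R) (p : simplex R n).
Local Open Scope ereal_scope.

Lemma msupport_wdirac : (forall i, (0 < p i)%R) ->
  msupport (wdirac x p) = range x.
Proof.
move=> p0; apply/seteqP; split => [t tS|_ [i _ <-] U _ Uxi].
  apply: contrapT => tx.
  have cl : closed (range x).
    apply: (@accessible_finite_set_closed R).1; last exact: finite_image.
    exact/hausdorff_accessible/order_hausdorff.
  have := tS (~` range x) (closed_openC cl) tx.
  rewrite /= /wdirac big1 ?ltxx// => i _.
  by rewrite diracE memNset ?mule0//= => /(_ (imageT _ _)).
apply: (@lt_le_trans _ _ (p i)%:E); first by rewrite lte_fin.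
rewrite /= /wdirac (bigD1 i)//= diracE mem_set// mule1 leeDl//.
rewrite sume_ge0// => k _.
by rewrite mule_ge0// lee_fin weight_ge0.
Qed.

Lemma card_range_ord : injective x -> (range x #= `I_n)%card.
Proof.
move=> x_inj; apply: (card_eq_trans (inj_card_eq _)).
  by move=> i k _ _; exact: x_inj.
by rewrite card_eq_sym; exact: card_II.
Qed.
End support.

(** * Asymptotics of L *)

Section asymptotics.
Context {R : realType}.
Variable b : R.
Hypothesis b1 : 1 < b.

Let c : R := ln b.
Let c0 : 0 < c. Proof. exact: ln_base_gt0. Qed.

(** This is sinh (L ln b) / L. *)
Definition sinh_ratio L : R := (b `^ L - b `^ (- L)) / (2 * L).

(** Both bounds come from 1 + t <= exp t: factor b^(-L), respectively b^L, out
    of b^L - b^(-L). *)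
Lemma sinh_ratio_bound L : 0 < L ->
  c * b `^ (- L) <= sinh_ratio L <= c * b `^ L.
Proof.
move=> L0.
have powE t : b `^ t = expR (t * c) by rewrite /powR gt_eqF ?(base_gt0 b1).
have h1 : 1 + 2 * L * c <= b `^ (2 * L) by rewrite powE expR_ge1Dx.
have h2 : 1 - 2 * L * c <= b `^ (- (2 * L)).
  by rewrite powE mulNr expR_ge1Dx.
have q0 : 0 < b `^ L by rewrite powR_gt0 ?base_gt0.
have r0 : 0 < b `^ (- L) by rewrite powR_gt0 ?base_gt0.
have E1 : b `^ L = b `^ (- L) * b `^ (2 * L).
  by rewrite -powRD_base//; congr powR; ring.
have E2 : b `^ (- L) = b `^ L * b `^ (- (2 * L)).
  by rewrite -powRD_base//; congr powR; ring.
rewrite /sinh_ratio ler_pdivlMr ?mulr_gt0// ler_pdivrMr ?mulr_gt0//.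
apply/andP; split.
  rewrite E1; have := ler_wpM2l (ltW r0) h1; lra.
rewrite E2; have := ler_wpM2l (ltW q0) h2; lra.
Qed.

(** Logarithm of the Levy equation after dividing numerator and denominator by
    2 L. *)
Lemma levy_equation_ratio n L : (0 < n)%N -> levy_equation b n L ->
  n%:R * L = (ln (1 + b * sinh_ratio L) - ln (1 + sinh_ratio L)) / (2 * c).
Proof.
move=> n0 hL; have [L0 _] := (levy_equationP b1 L n0).1 hL.
have [d0 /(congr1 (@ln R))] := hL.
have r0 : 0 < sinh_ratio L.
  have /andP[+ _] := sinh_ratio_bound L0; apply: lt_le_trans.
  by rewrite mulr_gt0// powR_gt0// base_gt0.
have r1 : 0 < 1 + sinh_ratio L by exact: addr_gt0.
have rb : 0 < 1 + b * sinh_ratio L.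
  by apply: addr_gt0 => //; apply: mulr_gt0 => //; exact: base_gt0.
have sE : b `^ L - b `^ (- L) = 2 * L * sinh_ratio L.
  by rewrite /sinh_ratio mulrC divfK// gt_eqF// mulr_gt0.
have -> : (2 * L + b * (b `^ L - b `^ (- L))) / (2 * L + b `^ L - b `^ (- L))
    = (1 + b * sinh_ratio L) / (1 + sinh_ratio L).
  rewrite -addrA sE; field; apply/andP; split; first by rewrite gt_eqF.
  by rewrite gt_eqF//; have := mulr_gt0 L0 r0; lra.
rewrite ln_powR ln_div ?posrE// => <-.
by rewrite /c; field; rewrite gt_eqF.
Qed.

Lemma levy_equation_cvg (u : nat -> R) :
  (forall n, (0 < n)%N -> levy_equation b n (u n)) ->
  n%:R * u n @[n --> \oo] --> (ln (1 + b * c) - ln (1 + c)) / (2 * c).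
Proof.
move=> hu; rewrite -(cvg_shiftS (fun n => n%:R * u n)).
have u0 n : 0 < u n.+1.
  by have [] := (levy_equationP b1 _ (ltn0Sn n)).1 (hu _ (ltn0Sn n)).
have u_le n : u n.+1 <= harmonic n.
  have [_ rb] := (levy_equationP b1 _ (ltn0Sn n)).1 (hu _ (ltn0Sn n)).
  have : b `^ (2 * n.+1%:R * u n.+1) <= b `^ 1.
    rewrite powRr1 ?(ltW (base_gt0 b1))// -[leRHS]rb lerDl.
    rewrite mulr_ge0 ?mulr_ge0 ?(ltW (u0 n))//.
    by rewrite sumr_ge0// => k _; exact: powR_ge0.
  rewrite ler_powR_base// /harmonic/= -div1r ler_pdivlMr//.
  have : 0 < n.+1%:R * u n.+1 by rewrite mulr_gt0.
  lra.
have ucvg : u n.+1 @[n --> \oo] --> (0 : R).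
  apply: (@squeeze_cvgr _ _ _ _ (fun=> 0) harmonic).
  - by apply: nearW => n; rewrite (ltW (u0 n)) u_le.
  - exact: cvg_cst.
  - exact: cvg_harmonic.
have pcvg : b `^ (u n.+1) @[n --> \oo] --> (1 : R).
  rewrite -[X in _ --> X](powRr0 b).
  apply: (@continuous_cvg _ _ _ _ _ _ (powR b)) => //.
  exact: continuous_powR_base.
have ncvg : b `^ (- u n.+1) @[n --> \oo] --> (1 : R).
  rewrite (_ : (fun n => _) = fun n => (b `^ (u n.+1))^-1); last first.
    by apply/funext => n; rewrite powRN.
  by rewrite -[X in _ --> X]invr1; apply: cvgV; rewrite ?oner_eq0.
have rcvg : sinh_ratio (u n.+1) @[n --> \oo] --> c.
  apply: (@squeeze_cvgr _ _ _ _ (fun n => c * b `^ (- u n.+1))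
    (fun n => c * b `^ (u n.+1))).
  - by apply: nearW => n; exact: sinh_ratio_bound.
  - by rewrite -[X in _ --> X]mulr1; apply: cvgM => //; exact: cvg_cst.
  - by rewrite -[X in _ --> X]mulr1; apply: cvgM => //; exact: cvg_cst.
have lncvg k : 0 < k ->
    ln (1 + k * sinh_ratio (u n.+1)) @[n --> \oo] --> ln (1 + k * c).
  move=> k0; apply: (@continuous_cvg _ _ _ _ _ _ (@ln R)).
    by apply: continuous_ln; rewrite addr_gt0// mulr_gt0.
  by apply: cvgD; [exact: cvg_cst|apply: cvgM => //; exact: cvg_cst].
rewrite (_ : (fun n => _) = fun n => (ln (1 + b * sinh_ratio (u n.+1))
    - ln (1 + 1 * sinh_ratio (u n.+1))) / (2 * c)); last first.
  by apply/funext => n; rewrite mul1r (levy_equation_ratio _ (hu _ _)).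
rewrite -[X in _ - ln (1 + X)](mul1r c); apply: cvgM; last exact: cvg_cst.
by apply: cvgB; apply: lncvg => //; exact: base_gt0.
Qed.
End asymptotics.

(** * The best approximation of the Benford measure *)

Theorem corollary3p14 (R : realType) (b : R)
    (beta : probability (measurableTypeR R) R)
    (hb : 1 < b) (hbeta : is_benford b beta) :
  (forall n : nat, (0 < n)%N ->
    exists (L : R) (x : 'I_n -> R) (p : simplex R n),
      [/\ unique (levy_equation b n) L,
          Xi b x /\ best_approx b n beta (wdirac x p),
          forall nu : probability (measurableTypeR R) R,
            best_approx b n beta nu ->
            forall A, measurable A -> nu A = wdirac x p A,
          forall i : 'I_n,
            let j : R := i.+1%:R in
            let z := b `^ ((2 * j - 1) * L)
                     + 2 * L * ((b `^ (2 * j * L) - 1) / (b `^ (2 * L) - 1)) in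
            [/\ x i = z - L,
                x i = b `^ (cumul p i - L) - L,
                cumul p i = (ln b)^-1 * ln z + L &
                cumul p i = ln (x i + L) / ln b + L] &
          (msupport (wdirac x p) #= `I_n)%card /\
          levy_dist b beta (wdirac x p) = levy_omega b * L]) /\
  (forall nu : nat -> probability (measurableTypeR R) R,
    (forall n : nat, (0 < n)%N -> best_approx b n beta (nu n)) ->
    (fun n : nat => n%:R * levy_dist b beta (nu n)) @ \oo -->
      (Num.max b 2 - 1) / (2 * b - 2)
        * ((ln (1 + b * ln b) - ln (1 + ln b)) / ln b)).
Proof.
split=> [n n0|nu nu_best].
  have [L L0 rL] := reach_root hb n0.
  pose p := opt_simplex hb L0 rL; pose x := @opt_atom R b n L.
  exists L, x, p; split.
  - split=> [|L' /(levy_equationP hb _ n0)[L'0 rL']].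
      exact/(levy_equationP hb _ n0).
    have [lt|lt|//] := ltgtP L L'.
      by have := reach_lt hb n0 (ltW L0) lt; rewrite rL rL' ltxx.
    by have := reach_lt hb n0 (ltW L'0) lt; rewrite rL rL' ltxx.
  - by split; [exact: opt_atom_Xi|exact: opt_best_approx].
  - by move=> mu; exact: best_approx_unique.
  - move=> i j z.
    have zE : z = node b L i.+1 by rewrite node_geometric.
    have cE : cumul p i = opt_cumul b L i.+1 by rewrite -(csum_opt hb L0 rL).
    rewrite cE powR_opt_cumul// zE /x /opt_atom subrK; split=> //.
    by rewrite mulrC.
  split; last exact: levy_dist_opt.
  rewrite msupport_wdirac; last by move=> i; exact: opt_weight_gt0.
  apply: card_range_ord => i k e.
  have {}e : opt_atom b L i = opt_atom b L k by [].
  have [ik|ki|/val_inj//] := ltngtP (val i) (val k).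
    by have := opt_atom_lt hb L0 ik; rewrite e ltxx.
  by have := opt_atom_lt hb L0 ki; rewrite e ltxx.
have /choice[L hL] n : exists L, (0 < n)%N -> levy_equation b n L.
  have [n0|] := ltnP 0 n; last by exists 0.
  have [L L0 rL] := reach_root hb n0.
  by exists L => _; apply/(levy_equationP hb _ n0).
have lc := ln_base_gt0 hb.
rewrite (_ : _ * _ = levy_omega b
    * ((ln (1 + b * ln b) - ln (1 + ln b)) / (2 * ln b))); last first.
  rewrite /levy_omega; field.
  by rewrite !gt_eqF// subr_gt0// ltr_pMr.
rewrite (_ : (fun n => _) = fun n => levy_omega b * (n%:R * L n)).
  by apply: cvgM; [exact: cvg_cst|exact: levy_equation_cvg].
(* At index 0 nothing is known about nu, but both sides carry the factor 0. *)
apply/funext => -[|n]; first by rewrite !mul0r mulr0.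
have [L0 rL] := (levy_equationP hb _ (ltn0Sn n)).1 (hL _ (ltn0Sn n)).
rewrite (levy_dist_best_approx hb hbeta _ L0 rL)//; last exact: nu_best.
by rewrite mulrCA.
Qed.
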